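(* (i) For positive integers $m\ge n$, the pair $(K_m,K_n)$ is competition-realizable if and only if one of the following holds: $n=1$; $m\ge n\ge 6$; $m\ge 10$ and $n=5$. (ii) For a positive integer $l$, the complete graph $K_l$ is $(1,2)$-step competition-realizable if and only if $l\ge 12$.
   Context: The competition graph $C(D)$ of a digraph $D$ is the graph on $V(D)$ in which distinct $u,v$ are adjacent iff they have a common out-neighbor in $D$. For graphs $G_1$ on $m$ vertices and $G_2$ on $n$ vertices, the pair $(G_1,G_2)$ is competition-realizable if the disjoint union of $G_1$ and $G_2$ is the competition graph of some orientation of the complete bipartite graph $K_{m,n}$ with bipartition $(V(G_1),V(G_2))$. For vertices $x,y$ of a digraph $H$, $d_H(x,y)$ is the length of a shortest directed $(x,y)$-path. The $(1,2)$-step competition graph $C_{1,2}(D)$ is the simple graph on $V(D)$ in which distinct $u,v$ are adjacent iff there is $w\neq u,v$ with either $d_{D-v}(u,w)\le 1$ and $d_{D-u}(v,w)\le 2$, or $d_{D-u}(v,w)\le 1$ and $d_{D-v}(u,w)\le 2$. A graph is $(1,2)$-step competition-realizable if it is isomorphic to $C_{1,2}(D)$ for some orientation $D$ of a complete bipartite graph $K_{m,n}$ with $m,n\ge1$. *)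

(* Defs.v *)
From mathcomp Require Import all_boot.

Set Implicit Arguments.
Unset Strict Implicit.
Unset Printing Implicit Defensive.

(* A digraph on the vertex set T is a relation D : rel T (D x y is the arc
   x -> y); a simple graph is a symmetric irreflexive relation. The definitions
   below taking graphs as arguments do not require symmetry and irreflexivity:
   realizability implies both, as competition graphs have them. *)

Definition complete_graph (T : finType) : rel T := [rel x y | x != y].

Definition complete_bipartite (T1 T2 : finType) : rel (T1 + T2)%type :=
  fun x y =>
    match x, y with
    | inl _, inr _ | inr _, inl _ => true
    | _, _ => false
    end.

Definition disjoint_union (T1 T2 : finType) (G1 : rel T1) (G2 : rel T2) :
    rel (T1 + T2)%type :=
  fun x y =>
    match x, y with
    | inl a, inl b => G1 a b
    | inr a, inr b => G2 a b
    | _, _ => false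
    end.

Definition orientation (T : finType) (G D : rel T) : Prop :=
  forall x y, G x y = (D x y || D y x) /\ ~~ (D x y && D y x).

Definition competition_graph (T : finType) (D : rel T) : rel T :=
  [rel u v | (u != v) && [exists w, D u w && D v w]].

Definition competition_realizable (T1 T2 : finType)
    (G1 : rel T1) (G2 : rel T2) : Prop :=
  exists D : rel (T1 + T2)%type,
    orientation (@complete_bipartite T1 T2) D /\
    disjoint_union G1 G2 =2 competition_graph D.

(* [path] describes walks; [uniq] makes it a directed path, and [size p] is
   its length. *)
Definition dipath (T : finType) (D : rel T) (x y : T) (p : seq T) : bool :=
  [&& path D x p, last x p == y & uniq (x :: p)].

(* d_D(x, y) = d; no d satisfies this when y is not reachable from x, that is
   when the distance is infinite. *)
Definition has_dist (T : finType) (D : rel T) (x y : T) (d : nat) : Prop :=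
  (exists2 p, dipath D x y p & size p = d) /\
  (forall p, dipath D x y p -> d <= size p).

Definition dist_le (T : finType) (D : rel T) (x y : T) (k : nat) : Prop :=
  exists2 d, has_dist D x y d & d <= k.

Definition del_vertex (T : finType) (D : rel T) (v : T) :
    rel {x : T | x != v} :=
  fun x y => D (val x) (val y).

(* d_{D - v}(x, y) <= k, for vertices x, y of D - v. *)
Definition dist_del_le (T : finType) (D : rel T) (v x y : T) (k : nat) : Prop :=
  exists (xv : x != v) (yv : y != v),
    dist_le (@del_vertex T D v) (exist _ x xv) (exist _ y yv) k.

Definition step12_competition_graph (T : finType) (D : rel T) (u v : T) : Prop :=
  u <> v /\
  exists w, [/\ w <> u, w <> v &
    (dist_del_le D v u w 1 /\ dist_del_le D u v w 2) \/
    (dist_del_le D u v w 1 /\ dist_del_le D v u w 2)].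

Definition step12_competition_realizable (T : finType) (G : rel T) : Prop :=
  exists (m n : nat) (D : rel ('I_m + 'I_n)%type),
    [/\ 1 <= m, 1 <= n, orientation (@complete_bipartite 'I_m 'I_n) D &
      exists2 f : T -> ('I_m + 'I_n)%type, bijective f &
        forall x y, G x y <-> step12_competition_graph D (f x) (f y)].

(* Main.v *)
(** Let [A i j] say that the arc between [i] and [j] goes from [i] to [j].  The
    pair of complete graphs is realized iff any two rows of [A] share a one and
    any two columns share a zero.  If both sides have at least two vertices,
    every row [A i] has at least three ones: for distinct [j], [j'] some row
    avoids both and still meets [A i], so [A i] is not contained in [{j, j'}].
    A row avoiding two columns then forces [n >= 5], and if [n = 5] it is
    exactly the complement of the two columns, so all ten complements of pairs
    occur as rows.  Conversely, the circulant 6 x 6 matrix of [{0, 1, 3}] and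
    the 10 x 5 matrix of all triples work, and duplicating rows and columns is
    harmless.

    In the (1,2)-step graph, vertices [u], [v] on the same side are adjacent iff
    they have a common out-neighbor, and on opposite sides iff [u] has an
    out-neighbor [j != v] and [v] has an out-neighbor [i != u]: whichever way the
    arc between [i] and [j] goes, it completes a path of length two.  So [K_l] is
    realizable iff [l = m + n] with [m, n >= 2] and [(K_m, K_n)]
    competition-realizable. *)
Require Import Defs.
From mathcomp Require Import all_boot zify.

Set Implicit Arguments.
Unset Strict Implicit.
Unset Printing Implicit Defensive.

(** * Realizing Boolean matrices *)

Definition rows_meet (T1 T2 : Type) (A : T1 -> T2 -> bool) : Prop :=
  forall i i', i <> i' -> exists j, A i j && A i' j.

(** The negation is there because the arc leaves [j] exactly when it does not leave [i]: this is the
    same orientation read from the other side. *)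
Definition co_transpose (T1 T2 : Type) (A : T1 -> T2 -> bool) : T2 -> T1 -> bool :=
  fun j i => ~~ A i j.

Definition realizing (T1 T2 : Type) (A : T1 -> T2 -> bool) : Prop :=
  rows_meet A /\ rows_meet (co_transpose A).

Lemma realizing_co_transpose (T1 T2 : Type) (A : T1 -> T2 -> bool) :
  realizing A -> realizing (co_transpose A).
Proof.
move=> [rA cA]; split=> // i i' /rA[j /andP[Aij Ai'j]].
by exists j; rewrite /co_transpose Aij Ai'j.
Qed.

Lemma neq_exists (T : finType) (x : T) : 1 < #|T| -> exists y, y != x.
Proof.
rewrite (cardD1 x) inE ltnS => /card_gt0P[y].
by rewrite !inE andbT; exists y.
Qed.

(** * Lower bounds on the sizes of the sides *)

Section Necessity.

Variables (T1 T2 : finType) (A : T1 -> T2 -> bool).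
Hypotheses (A_real : realizing A) (gt1_T1 : 1 < #|T1|) (gt1_T2 : 1 < #|T2|).

Lemma row_card_gt2 i : 2 < #|A i|.
Proof.
have [rA cA] := A_real.
have [i' /eqP ne_i] := neq_exists i gt1_T1.
have [j /andP[_ Aij]] := rA _ _ ne_i.
(* A row [k] avoiding [j] and [j'] differs from row [i], which contains [j]; the two rows meet in a
   third column. *)
have escape j' : j' != j -> exists j'', [&& A i j'', j'' != j & j'' != j'].
  move=> /eqP ne_j; have [k /andP[nAkj' nAkj]] := cA _ _ ne_j.
  have ne_k : i <> k by move=> eq_ik; move: nAkj; rewrite /co_transpose -eq_ik Aij.
  have [j'' /andP[Aij'' Akj'']] := rA _ _ ne_k.
  exists j''; rewrite Aij'' /=; apply/andP; split.
    by apply: contraNneq nAkj => <-.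
  by apply: contraNneq nAkj' => <-.
have [j0 ne_j0] := neq_exists j gt1_T2.
have [j1 /and3P[Aij1 ne_j1 _]] := escape _ ne_j0.
have [j2 /and3P[Aij2 ne_j2 ne_j21]] := escape _ ne_j1.
apply/card_gt2P; exists j, j1, j2; split; split=> //; by rewrite eq_sym.
Qed.

Let zeros i := ~: [set j | A i j].

Lemma zeros_card i : #|zeros i| + 3 <= #|T2|.
Proof.
rewrite -(cardsC [set j | A i j]) addnC leq_add2r cardsE.
exact: row_card_gt2.
Qed.

Lemma pair_sub_zeros (B : {set T2}) : #|B| = 2 -> exists i, B \subset zeros i.
Proof.
move=> /eqP/cards2P[j [j' [/eqP ne_j ->]]].
have [i /andP[nAij nAij']] := A_real.2 _ _ ne_j.
by exists i; apply/subsetP=> x; rewrite !inE => /orP[] /eqP ->.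
Qed.

Lemma realizing_card_ge5 : 5 <= #|T2|.
Proof.
have /card_gt0P[j _] := ltnW gt1_T2.
have [j' ne_j] := neq_exists j gt1_T2.
have [|i /subset_leq_card] := @pair_sub_zeros [set j'; j]; rewrite cards2 ne_j //.
by have := zeros_card i; lia.
Qed.

Lemma realizing_card5 : #|T2| = 5 -> 10 <= #|T1|.
Proof.
move=> T2_5.
have <- : #|[set B : {set T2} | #|B| == 2]| = 10 by rewrite card_draws T2_5.
rewrite -cardsT; apply: leq_trans (leq_imset_card zeros _).
apply/subset_leq_card/subsetP=> B; rewrite inE => /eqP B2.
have [i sBz] := pair_sub_zeros B2.
(* With five columns row [i] has at most two zeros, so containing the pair [B] forces equality. *)
apply/imsetP; exists i => //; apply/eqP.
by rewrite eqEcard sBz B2; have := zeros_card i; lia.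
Qed.

End Necessity.

(** * Orientations of complete bipartite graphs as matrices *)

Section Bipartite.

Variables T1 T2 : finType.

Definition bip_digraph (A : T1 -> T2 -> bool) : rel (T1 + T2)%type :=
  fun x y =>
    match x, y with
    | inl i, inr j => A i j
    | inr j, inl i => ~~ A i j
    | _, _ => false
    end.

Lemma bip_digraph_orientation A :
  orientation (@complete_bipartite T1 T2) (bip_digraph A).
Proof. by move=> [i|j] [i'|j'] //=; case: (A _ _). Qed.

Lemma orientation_bip_digraph D :
  orientation (@complete_bipartite T1 T2) D ->
  D =2 bip_digraph (fun i j => D (inl i) (inr j)).
Proof.
move=> oD x y; have := oD x y; case: x y => [i|j] [i'|j'] //=;
  by do 2!case: (D _ _) => //=; case.
Qed.

Lemma competition_realizable_complete :
  competition_realizable (@complete_graph T1) (@complete_graph T2) <->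
  exists A : T1 -> T2 -> bool, realizing A.
Proof.
split=> [[D [oD eqD]] | [A [rA cA]]].
  have DE := orientation_bip_digraph oD.
  exists (fun i j => D (inl i) (inr j)); split=> [i i' /eqP ne_i | j j' /eqP ne_j].
    have := eqD (inl i) (inl i'); rewrite /= /complete_graph /= ne_i.
    by case/esym/andP=> _ /existsP[[k|j]]; rewrite !DE //; exists j.
  have := eqD (inr j) (inr j'); rewrite /= /complete_graph /= ne_j.
  by case/esym/andP=> _ /existsP[[i|k]]; rewrite !DE //; exists i.
exists (bip_digraph A); split; first exact: bip_digraph_orientation.
move=> [i|j] [i'|j']; rewrite /complete_graph /competition_graph /=.
- rewrite (inj_eq inl_inj); case: eqP => //= ne_i.
  by have [j Aj] := rA _ _ ne_i; apply/esym/existsP; exists (inr j).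
- by apply/esym/existsP=> -[[]] //= k; rewrite andbF.
- by apply/esym/existsP=> -[[]] //= k; rewrite andbF.
- rewrite (inj_eq inr_inj); case: eqP => //= ne_j.
  by have [i Ai] := cA _ _ ne_j; apply/esym/existsP; exists (inl i).
Qed.

End Bipartite.

(** * Distances and (1,2)-step adjacency *)

Lemma dist_leP (T : finType) (D : rel T) x y k :
  dist_le D x y k <-> exists p, [/\ path D x p, last x p = y & size p <= k].
Proof.
split=> [[d [[p /and3P[Dp /eqP py _] <-] _] le_dk] | [p0 [Dp0 p0y le_p0k]]].
  by exists p.
(* The walk shortens to a path that is no longer; tuples keep path existence decidable, so that a
   least length can be taken. *)
have ex_d : exists d, [exists p : d.-tuple T, dipath D x y p] && (d <= k).
  case/shortenP: Dp0 p0y => p Dp Up sub_p py.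
  exists (size p); rewrite (leq_trans _ le_p0k) ?andbT; last first.
    by apply: uniq_leq_size => //; case/andP: Up.
  by apply/existsP; exists (in_tuple p); rewrite /dipath Dp Up py eqxx.
case: (ex_minnP ex_d) => d /andP[/existsP[p Dp] le_dk] min_d.
exists d => //; split; first by exists p; rewrite ?size_tuple.
move=> q Dq; case: (leqP (size q) k) => [le_qk|/ltnW/(leq_trans le_dk)//].
by apply: min_d; rewrite le_qk andbT; apply/existsP; exists (in_tuple q).
Qed.

Section Step12.

Variables (T : finType) (D : rel T).
Implicit Types u v w x y : T.

Lemma dist_del_le1 v x y : x <> y ->
  dist_del_le D v x y 1 <-> [/\ x <> v, y <> v & D x y].
Proof.
move=> ne_xy; split=> [[xv [yv /dist_leP[[|z [|? ?]] [//= Dz eq_y _]]]] | [/eqP xv /eqP yv Dxy]].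
- by case: eq_y.
- by split; [exact/eqP | exact/eqP | move: Dz; rewrite eq_y /del_vertex /= andbT].
- exists xv, yv; apply/dist_leP; exists [:: exist _ y yv].
  by rewrite /= /del_vertex /= Dxy.
Qed.

Lemma dist_del_le2 v x y : x <> y ->
  dist_del_le D v x y 2 <->
  [/\ x <> v, y <> v & D x y \/ exists z, [/\ z <> v, D x z & D z y]].
Proof.
move=> ne_xy; split.
  case=> xv [yv /dist_leP[p [Dp eq_y le_p]]]; split; [exact/eqP | exact/eqP |].
  case: p Dp eq_y le_p => [|z [|t [|? ?]]] //=; first by move=> _ [].
    by rewrite andbT => Dxz eq_z _; rewrite eq_z in Dxz; left.
  by rewrite andbT => /andP[Dxz Dzt] eq_t _; rewrite eq_t in Dzt; right;
     exists (val z); split=> //; apply/eqP/(valP z).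
case=> /eqP xv /eqP yv; case=> [Dxy | [z [/eqP zv Dxz Dzy]]];
  exists xv, yv; apply/dist_leP.
  by exists [:: exist _ y yv]; rewrite /= /del_vertex /= Dxy.
by exists [:: exist _ z zv; exist _ y yv]; rewrite /= /del_vertex /= Dxz Dzy.
Qed.

Lemma step12_sym u v :
  step12_competition_graph D u v -> step12_competition_graph D v u.
Proof.
by move=> [ne_uv [w [wu wv dw]]]; split=> [/esym//|]; exists w; split=> //;
   case: dw; [right | left].
Qed.

Lemma step12P u v : step12_competition_graph D u v <->
  u <> v /\ exists w, [/\ w <> u, w <> v &
    D u w /\ (D v w \/ exists z, [/\ z <> u, D v z & D z w]) \/
    D v w /\ (D u w \/ exists z, [/\ z <> v, D u z & D z w])].
Proof.
split=> -[ne_uv [w [wu wv dw]]]; split=> //; exists w; split=> //;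
  move: dw; rewrite !dist_del_le1 ?dist_del_le2; try exact: nesym.
  by case=> -[[_ _ ?] [_ _ ?]]; [left | right].
by case=> -[? ?]; [left | right]; split; split=> //; exact: nesym.
Qed.

End Step12.

Section BipartiteStep12.

Variables (T1 T2 : finType) (A : T1 -> T2 -> bool).

(** A vertex one arc away from [i] or [i'] lies on the opposite side, where no walk of length two
    from the other can end; so both reach it by an arc. *)
Lemma step12_inl D i i' : D =2 bip_digraph A ->
  step12_competition_graph D (inl i) (inl i') <->
  i <> i' /\ exists j, A i j && A i' j.
Proof.
move=> DE; rewrite step12P; split=> [[ne [w [_ _ dw]]] | [ne [j /andP[Aij Ai'j]]]].
  split; first by move=> eq_i; case: ne; rewrite eq_i.
  case: w dw => [k|j] /=; rewrite !DE /=; first by case=> -[].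
  exists j; by case: dw => -[-> []]; rewrite ?andbT // => -[] [k|k] []; rewrite !DE.
split; first by case.
by exists (inr j); split=> //; left; rewrite !DE; split=> //; left.
Qed.

Lemma step12_inr D j j' : D =2 bip_digraph A ->
  step12_competition_graph D (inr j) (inr j') <->
  j <> j' /\ exists i, ~~ A i j && ~~ A i j'.
Proof.
move=> DE; rewrite step12P; split=> [[ne [w [_ _ dw]]] | [ne [i /andP[Aij Aij']]]].
  split; first by move=> eq_j; case: ne; rewrite eq_j.
  case: w dw => [i|k] /=; rewrite !DE /=; last by case=> -[].
  exists i; by case: dw => -[-> []]; rewrite ?andbT // => -[] [k|k] []; rewrite !DE.
split; first by case.
by exists (inl i); split=> //; left; rewrite !DE; split=> //; left.
Qed.

Lemma step12_inl_inr D i j : D =2 bip_digraph A ->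
  step12_competition_graph D (inl i) (inr j) <->
  exists i' j', [/\ i' <> i, j' <> j, A i j' & ~~ A i' j].
Proof.
move=> DE; rewrite step12P; split.
  case=> _ [[i'|j'] [ne_i ne_j]]; rewrite !DE /= => -[] [// Aw] [// | [[k|k] []]];
    rewrite !DE //= => ne_k Ak _.
    by exists i', k; split=> // eq_k; [case: ne_i | case: ne_k]; rewrite eq_k.
  by exists k, j'; split=> // eq_k; [case: ne_k | case: ne_j]; rewrite eq_k.
case=> i' [j' [ne_i ne_j Aij' nAi'j]]; split=> //.
(* The head of the arc between [i'] and [j'] serves as the common target: one end reaches it by an
   arc, the other through the tail. *)
case Ai'j': (A i' j').
  exists (inr j'); split=> //; first by case.
  by left; rewrite !DE; split=> //; right; exists (inl i'); rewrite !DE; split=> //; case.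
exists (inl i'); split=> //; first by case.
right; rewrite !DE; split=> //; right; exists (inr j'); rewrite !DE /= Ai'j'.
by split=> //; case.
Qed.

End BipartiteStep12.

Lemma card_gt1_neq (T : finType) (P : pred T) x :
  1 < #|P| -> exists2 y, y <> x & P y.
Proof.
case/card_gt1P=> y [z [Py Pz ne_yz]].
have [eq_yx | /eqP ne_yx] := eqVneq y x; last by exists y.
by exists z => //; apply/eqP; rewrite eq_sym -eq_yx.
Qed.

Lemma realizing_step12 (T1 T2 : finType) (A : T1 -> T2 -> bool) :
  1 < #|T1| -> 1 < #|T2| -> realizing A ->
  forall x y, step12_competition_graph (bip_digraph A) x y <-> x <> y.
Proof.
move=> T1_gt1 T2_gt1 A_real.
have [rA cA] := A_real; have DE : bip_digraph A =2 bip_digraph A by [].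
have cross i j : step12_competition_graph (bip_digraph A) (inl i) (inr j).
  apply/(step12_inl_inr _ _ DE).
  have [j' ne_j Aij'] := card_gt1_neq j (ltnW (row_card_gt2 A_real T1_gt1 T2_gt1 i)).
  have := row_card_gt2 (realizing_co_transpose A_real) T2_gt1 T1_gt1 j.
  by move=> /ltnW/(card_gt1_neq i)[i' ne_i nAi'j]; exists i', j'.
move=> x y; split=> [[] // | ].
case: x y => [i|j] [i'|j'] ne; last 1 first.
- have ne_j : j <> j' by move=> eq_j; rewrite eq_j in ne.
  by apply/(step12_inr _ _ DE); split=> //; apply: cA.
- have ne_i : i <> i' by move=> eq_i; rewrite eq_i in ne.
  by apply/(step12_inl _ _ DE); split=> //; apply: rA.
- exact: cross.
- exact/step12_sym/cross.
Qed.

Lemma step12_realizing (T1 T2 : finType) (D : rel (T1 + T2)%type) :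
  0 < #|T1| -> 0 < #|T2| -> orientation (@complete_bipartite T1 T2) D ->
  (forall x y, x <> y -> step12_competition_graph D x y) ->
  [/\ 1 < #|T1|, 1 < #|T2| & exists A : T1 -> T2 -> bool, realizing A].
Proof.
move=> /card_gt0P[i0 _] /card_gt0P[j0 _] /orientation_bip_digraph DE Dxy.
(* A single edge across the sides already needs a second vertex on each side. *)
have /(step12_inl_inr _ _ DE)[] : step12_competition_graph D (inl i0) (inr j0).
  exact: Dxy.
move=> i [j [/eqP ne_i /eqP ne_j _ _]]; split.
- by apply/card_gt1P; exists i, i0.
- by apply/card_gt1P; exists j, j0.
exists (fun i j => D (inl i) (inr j)); split=> [i1 i2 ne12 | j1 j2 ne12].
  have /(step12_inl _ _ DE)[] // : step12_competition_graph D (inl i1) (inl i2).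
  by apply: Dxy => -[].
have /(step12_inr _ _ DE)[] // : step12_competition_graph D (inr j1) (inr j2).
by apply: Dxy => -[].
Qed.

(** * Explicit matrices, verified by computation *)

Definition check_meet (k1 k2 : nat) (a : nat -> nat -> bool) : bool :=
  all (fun i => all (fun i' => has (fun j => a i j && a i' j) (iota 0 k2))
    (iota 0 k1)) (iota 0 k1).

(** Truncation by [minn] repeats the last row and column. Distinct rows may thus become equal, so
    the check also compares each row with itself. *)
Lemma check_meetP k1 k2 n a : k2 < n -> check_meet k1.+1 k2.+1 a ->
  forall i i', exists j : 'I_n,
    a (minn i k1) (minn j k2) && a (minn i' k1) (minn j k2).
Proof.
move=> lt_k2n chk i i'.
have min_in l : minn l k1 \in iota 0 k1.+1 by rewrite mem_iota /= add0n ltnS geq_minr.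
have /allP/(_ _ (min_in i')) := allP chk _ (min_in i).
case/hasP=> j; rewrite mem_iota add0n ltnS /= => le_jk2 aj.
have lt_jn : j < n by exact: leq_ltn_trans lt_k2n.
by exists (Ordinal lt_jn); rewrite /= (minn_idPl le_jk2).
Qed.

Lemma check_realizing k1 k2 m n a :
  k1 < m -> k2 < n -> check_meet k1.+1 k2.+1 a ->
  check_meet k2.+1 k1.+1 (co_transpose a) ->
  exists A : 'I_m -> 'I_n -> bool, realizing A.
Proof.
move=> lt_k1m lt_k2n chk chkT.
exists (fun i j => a (minn i k1) (minn j k2)); split=> [i i' _ | j j' _].
  exact: check_meetP chk i i'.
exact: check_meetP chkT j j'.
Qed.

Lemma realizing_ge6 m n : 6 <= m -> 6 <= n ->
  exists A : 'I_m -> 'I_n -> bool, realizing A.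
Proof.
move=> m_ge6 n_ge6.
(* Differences within [{0, 1, 3}], and within its complement [{2, 4, 5}], cover all residues modulo
   6, so any two translates meet. *)
pose a i j := (j + (6 - i)) %% 6 \in [:: 0; 1; 3].
by apply: (@check_realizing 5 5 m n a); vm_compute.
Qed.

(* The ten triples in Z/5 are the translates of {0,1,2} and of {0,1,3}. *)
Lemma realizing_10_5 m : 10 <= m -> exists A : 'I_m -> 'I_5 -> bool, realizing A.
Proof.
move=> m_ge10.
pose a i j := (j + (10 - i)) %% 5 \in [:: 0; 1; if i < 5 then 2 else 3].
by apply: (@check_realizing 9 4 m 5 a); vm_compute.
Qed.

Lemma realizing_1 m : exists A : 'I_m -> 'I_1 -> bool, realizing A.
Proof.
exists (fun _ _ => true); split=> [i i' _ | j j' []]; last by rewrite !ord1.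
by exists ord0.
Qed.

Theorem theorem3p5 :
  (forall m n : nat, 1 <= n -> n <= m ->
     (competition_realizable (@complete_graph 'I_m) (@complete_graph 'I_n) <->
      n = 1 \/ (n <= m /\ 6 <= n) \/ (10 <= m /\ n = 5)))
  /\
  (forall l : nat, 1 <= l ->
     (step12_competition_realizable (@complete_graph 'I_l) <-> 12 <= l)).
Proof.
split=> [m n n_gt0 le_nm | l _].
  rewrite competition_realizable_complete; split=> [[A A_real] | ].
    have [|n_gt1] := leqP n 1; first by lia.
    have m_gt1 : 1 < #|'I_m| by rewrite card_ord; lia.
    have n_gt1' : 1 < #|'I_n| by rewrite card_ord.
    have := realizing_card_ge5 A_real m_gt1 n_gt1'.
    by have := realizing_card5 A_real m_gt1 n_gt1'; rewrite !card_ord; lia.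
  case=> [-> | [[_ n_ge6] | [m_ge10 ->]]]; first exact: realizing_1.
    exact: realizing_ge6 (leq_trans n_ge6 le_nm) n_ge6.
  exact: realizing_10_5.
split=> [[m [n [D [m_gt0 n_gt0 oD [f bij_f fD]]]]] | l_ge12].
  have -> : l = m + n.
    by have := bij_eq_card bij_f; rewrite card_sum !card_ord.
  have [||x y ne_xy|] := step12_realizing _ _ oD; rewrite ?card_ord //.
    case: bij_f => g fK gK; rewrite -(gK x) -(gK y) -fD /complete_graph /=.
    by apply/eqP=> eq_g; apply: ne_xy; rewrite -(gK x) eq_g gK.
  (* Applied from both sides, the bounds leave either two sides of at least 6, or one of 5 and
     another of at least 10; hence at least 12 vertices. *)
  move=> m_gt1 n_gt1 [A A_real]; have B_real := realizing_co_transpose A_real.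
  have m_gt1' : 1 < #|'I_m| by rewrite card_ord.
  have n_gt1' : 1 < #|'I_n| by rewrite card_ord.
  have := realizing_card_ge5 A_real m_gt1' n_gt1'.
  have := realizing_card5 A_real m_gt1' n_gt1'.
  have := realizing_card_ge5 B_real n_gt1' m_gt1'.
  by have := realizing_card5 B_real n_gt1' m_gt1'; rewrite !card_ord; lia.
have [n n_ge6 ->] : exists2 n, 6 <= n & l = 6 + n by exists (l - 6); lia.
have [A A_real] := realizing_ge6 (leqnn 6) n_ge6.
exists 6, n, (bip_digraph A); split=> //; first by lia.
  exact: bip_digraph_orientation.
exists (@split 6 n); first by exists unsplit; [exact: splitK | exact: unsplitK].
move=> x y; rewrite realizing_step12 ?card_ord //; last by lia.
rewrite /complete_graph /=; split=> [/eqP ne_xy eq_s | ne_s].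
  by apply: ne_xy; apply: (can_inj (@splitK 6 n)).
by apply/eqP=> eq_xy; apply: ne_s; rewrite eq_xy.
Qed.
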